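(* Let $d\in\mathbb{N}$, let $H$ be a Hilbert space, let $\rho:\mathrm{Pol}(U_d^+)\to B(H)$ be a unital $^*$-representation, put $R=(\rho(u_{jk}))_{j,k=1}^d\in M_d(B(H))$, and let $V\in M_d(H)$. Then the following conditions are equivalent: (i) there is a $\rho$-$\epsilon$-cocycle $\eta$ on $\mathrm{Pol}(U_d^+)$ satisfying $V=(\eta(u_{jk}))_{j,k=1}^d$; (ii) $(R^*V)^t=\bar RV^t$. Moreover, when these hold, the matrix $W=(\eta(u_{jk}^* ))_{j,k=1}^d\in M_d(H)$ satisfies $W=-\bar RV^t$.
   Context: $\mathrm{Pol}(U_d^+)$ is the universal unital $^*$-algebra generated by $u_{jk}$, $1\le j,k\le d$, subject to $uu^*=u^*u=I$ and $\bar uu^t=u^t\bar u=I$, where $u=(u_{jk})$, $\bar u=(u_{jk}^* )$, $u^t=(u_{kj})$. Its character $\epsilon$ is the unital $^*$-homomorphism to $\mathbb{C}$ with $\epsilon(u_{jk})=\delta_{jk}$. A $\rho$-$\epsilon$-cocycle is a linear map $\eta:\mathrm{Pol}(U_d^+)\to H$ with $\eta(ab)=\rho(a)\eta(b)+\eta(a)\epsilon(b)$ for all $a,b$. Matrix conventions: $\bar R=(R_{jk}^* )_{j,k}$, $R^*=(R_{kj}^* )_{j,k}$; the transpose is $(X^t)_{jk}=X_{kj}$ for matrices over $B(H)$ or over $H$; for $X\in M_d(B(H))$ and $Y\in M_d(H)$, $(XY)_{jk}=\sum_{p=1}^dX_{jp}Y_{pk}\in H$. *)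

(* Defs.v *)
From HB Require Import structures.
From mathcomp Require Import all_boot all_order all_algebra.
From mathcomp Require Import all_classical all_reals all_analysis.
From mathcomp Require Import ring lra.
From mathcomp.real_closed Require Import complex.

Set Implicit Arguments.
Unset Strict Implicit.
Unset Printing Implicit Defensive.

Import Order.TTheory GRing.Theory Num.Theory.
Import numFieldNormedType.Exports.

Local Open Scope classical_set_scope.
Local Open Scope ring_scope.
Local Open Scope quotient_scope.

(* Kept on [pzRingType], since the bounded operators on the zero Hilbert space
   form the zero ring; [algType] requires [1 != 0]. *)
HB.mixin Record isStarRing A of GRing.PzRing A := {
  star : A -> A;
  starK : involutive star;
  starD : {morph star : a b / a + b};
  starM : forall a b, star (a * b) = star b * star a
}.

#[short(type="starRingType")]
HB.structure Definition StarRing := {A of GRing.PzRing A & isStarRing A}.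

HB.mixin Record isStarAlgebra (C : numClosedFieldType) A
    of StarRing A & GRing.Algebra C A := {
  starZ : forall (k : C) (a : A), star (k *: a) = Num.conj k *: star a
}.

#[short(type="starAlgType")]
HB.structure Definition StarAlgebra (C : numClosedFieldType) :=
  {A of StarRing A & GRing.Algebra C A & isStarAlgebra C A}.

Section ScalarStarAlgebra.
Variable C : numClosedFieldType.

HB.instance Definition _ := isStarRing.Build C^o
  (@conjCK C) (rmorphD Num.conj)
  (fun a b => etrans (rmorphM Num.conj a b) (mulrC _ _)).
HB.instance Definition _ := isStarAlgebra.Build C C^o (rmorphM Num.conj).
End ScalarStarAlgebra.

Section StarMatrix.
Variable A : starRingType.

Definition barmx m n (X : 'M[A]_(m, n)) : 'M[A]_(m, n) := map_mx star X.
Definition adjmx m n (X : 'M[A]_(m, n)) : 'M[A]_(n, m) := (barmx X)^T.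

Definition biunitary d (u : 'M[A]_d) : Prop :=
  [/\ u *m adjmx u = 1%:M, adjmx u *m u = 1%:M,
      barmx u *m u^T = 1%:M & u^T *m barmx u = 1%:M].
End StarMatrix.

(* Pol(U_d^+) by generators and relations: formal *-algebra expressions in the
   u_jk, modulo the smallest *-algebra congruence containing the four matrix
   relations (written out entrywise). *)
Section PolUTerms.
Variables (C : numClosedFieldType) (d : nat).

Inductive uterm : Type :=
| UGen of 'I_d & 'I_d
| UZero
| UOne
| UOpp of uterm
| UAdd of uterm & uterm
| UMul of uterm & uterm
| UScale of C & uterm
| UStar of uterm.

Definition udelta (j k : 'I_d) : uterm := if j == k then UOne else UZero.

Inductive ueq : uterm -> uterm -> Prop :=
| ueq_refl a : ueq a a
| ueq_sym a b : ueq a b -> ueq b a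
| ueq_trans a b c : ueq a b -> ueq b c -> ueq a c
| ueq_opp a a' : ueq a a' -> ueq (UOpp a) (UOpp a')
| ueq_add a a' b b' : ueq a a' -> ueq b b' -> ueq (UAdd a b) (UAdd a' b')
| ueq_mul a a' b b' : ueq a a' -> ueq b b' -> ueq (UMul a b) (UMul a' b')
| ueq_scale k a a' : ueq a a' -> ueq (UScale k a) (UScale k a')
| ueq_star a a' : ueq a a' -> ueq (UStar a) (UStar a')
| ueq_addA a b c : ueq (UAdd a (UAdd b c)) (UAdd (UAdd a b) c)
| ueq_addC a b : ueq (UAdd a b) (UAdd b a)
| ueq_add0 a : ueq (UAdd UZero a) a
| ueq_addN a : ueq (UAdd (UOpp a) a) UZero
| ueq_mulA a b c : ueq (UMul a (UMul b c)) (UMul (UMul a b) c)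
| ueq_mul1l a : ueq (UMul UOne a) a
| ueq_mul1r a : ueq (UMul a UOne) a
| ueq_mulDl a b c : ueq (UMul (UAdd a b) c) (UAdd (UMul a c) (UMul b c))
| ueq_mulDr a b c : ueq (UMul a (UAdd b c)) (UAdd (UMul a b) (UMul a c))
| ueq_scaleA k l a : ueq (UScale k (UScale l a)) (UScale (k * l) a)
| ueq_scale1 a : ueq (UScale 1 a) a
| ueq_scaleDr k a b :
    ueq (UScale k (UAdd a b)) (UAdd (UScale k a) (UScale k b))
| ueq_scaleDl k l a :
    ueq (UScale (k + l) a) (UAdd (UScale k a) (UScale l a))
| ueq_scaleAl k a b : ueq (UScale k (UMul a b)) (UMul (UScale k a) b)
| ueq_scaleAr k a b : ueq (UScale k (UMul a b)) (UMul a (UScale k b))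
| ueq_starK a : ueq (UStar (UStar a)) a
| ueq_starD a b : ueq (UStar (UAdd a b)) (UAdd (UStar a) (UStar b))
| ueq_starM a b : ueq (UStar (UMul a b)) (UMul (UStar b) (UStar a))
| ueq_starZ k a : ueq (UStar (UScale k a)) (UScale (Num.conj k) (UStar a))
| ueq_u_ustar j k :
    ueq (\big[UAdd/UZero]_(p < d) UMul (UGen j p) (UStar (UGen k p)))
        (udelta j k)
| ueq_ustar_u j k :
    ueq (\big[UAdd/UZero]_(p < d) UMul (UStar (UGen p j)) (UGen p k))
        (udelta j k)
| ueq_ubar_ut j k :
    ueq (\big[UAdd/UZero]_(p < d) UMul (UStar (UGen j p)) (UGen k p))
        (udelta j k)
| ueq_ut_ubar j k :
    ueq (\big[UAdd/UZero]_(p < d) UMul (UGen p j) (UStar (UGen p k)))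
        (udelta j k).

HB.instance Definition _ := gen_eqMixin uterm.
HB.instance Definition _ := gen_choiceMixin uterm.

Definition ueqb (a b : uterm) : bool := `[< ueq a b >].

Lemma ueqb_refl : reflexive ueqb.
Proof. by move=> a; apply/asboolP; exact: ueq_refl. Qed.

Lemma ueqb_sym : symmetric ueqb.
Proof. by move=> a b; apply/idP/idP => /asboolP/ueq_sym/asboolP. Qed.

Lemma ueqb_trans : transitive ueqb.
Proof.
by move=> b a c /asboolP ab /asboolP bc; apply/asboolP; exact: ueq_trans bc.
Qed.

Canonical ueq_equiv := EquivRel ueqb ueqb_refl ueqb_sym ueqb_trans.

Definition PolU : Type := {eq_quot ueqb}.
HB.instance Definition _ := Choice.on PolU.
HB.instance Definition _ := EqQuotient.on PolU.

Lemma PolU_eqP a b : \pi_PolU a = \pi_PolU b <-> ueq a b.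
Proof.
split=> [/eqP|ab]; last by apply/eqP; rewrite eqmodE; apply/asboolP.
by rewrite eqmodE => /asboolP.
Qed.

Lemma PolU_repr a : ueq (repr (\pi_PolU a)) a.
Proof. by apply/PolU_eqP; rewrite reprK. Qed.

Definition polu_opp (x : PolU) : PolU := \pi_PolU (UOpp (repr x)).
Definition polu_add (x y : PolU) : PolU := \pi_PolU (UAdd (repr x) (repr y)).
Definition polu_mul (x y : PolU) : PolU := \pi_PolU (UMul (repr x) (repr y)).
Definition polu_scale (k : C) (x : PolU) : PolU := \pi_PolU (UScale k (repr x)).
Definition polu_star (x : PolU) : PolU := \pi_PolU (UStar (repr x)).

Lemma pi_opp a : polu_opp (\pi_PolU a) = \pi_PolU (UOpp a).
Proof. by apply/PolU_eqP; apply: ueq_opp; exact: PolU_repr. Qed.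
Lemma pi_add a b : polu_add (\pi_PolU a) (\pi_PolU b) = \pi_PolU (UAdd a b).
Proof. by apply/PolU_eqP; apply: ueq_add; exact: PolU_repr. Qed.
Lemma pi_mul a b : polu_mul (\pi_PolU a) (\pi_PolU b) = \pi_PolU (UMul a b).
Proof. by apply/PolU_eqP; apply: ueq_mul; exact: PolU_repr. Qed.
Lemma pi_scale k a : polu_scale k (\pi_PolU a) = \pi_PolU (UScale k a).
Proof. by apply/PolU_eqP; apply: ueq_scale; exact: PolU_repr. Qed.
Lemma pi_star a : polu_star (\pi_PolU a) = \pi_PolU (UStar a).
Proof. by apply/PolU_eqP; apply: ueq_star; exact: PolU_repr. Qed.

Lemma PolU_ind_pi (P : PolU -> Prop) :
  (forall a, P (\pi_PolU a)) -> forall x, P x.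
Proof. by move=> Pa x; rewrite -[x]reprK. Qed.

Let piE := (pi_opp, pi_add, pi_mul, pi_scale, pi_star).

Ltac polu c := repeat (elim/PolU_ind_pi => ?); rewrite ?piE;
  apply/PolU_eqP; apply: c.

Fact polu_addA : associative polu_add. Proof. by polu ueq_addA. Qed.
Fact polu_addC : commutative polu_add. Proof. by polu ueq_addC. Qed.
Fact polu_add0 : left_id (\pi_PolU UZero : PolU) polu_add.
Proof. by polu ueq_add0. Qed.
Fact polu_addN : left_inverse (\pi_PolU UZero : PolU) polu_opp polu_add.
Proof. by polu ueq_addN. Qed.

HB.instance Definition _ :=
  GRing.isZmodule.Build PolU polu_addA polu_addC polu_add0 polu_addN.

Fact polu_mulA : associative polu_mul. Proof. by polu ueq_mulA. Qed.
Fact polu_mul1 : left_id (\pi_PolU UOne : PolU) polu_mul.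
Proof. by polu ueq_mul1l. Qed.
Fact polu_mulr1 : right_id (\pi_PolU UOne : PolU) polu_mul.
Proof. by polu ueq_mul1r. Qed.
Fact polu_mulDl : left_distributive polu_mul +%R.
Proof.
by do 3 elim/PolU_ind_pi => ?; rewrite /+%R /= !piE; apply/PolU_eqP; constructor.
Qed.
Fact polu_mulDr : right_distributive polu_mul +%R.
Proof.
by do 3 elim/PolU_ind_pi => ?; rewrite /+%R /= !piE; apply/PolU_eqP; constructor.
Qed.

HB.instance Definition _ := GRing.Zmodule_isPzRing.Build PolU
  polu_mulA polu_mul1 polu_mulr1 polu_mulDl polu_mulDr.

Fact polu_scaleA k l x : polu_scale k (polu_scale l x) = polu_scale (k * l) x.
Proof. by elim/PolU_ind_pi: x => x; rewrite !piE; apply/PolU_eqP; constructor. Qed.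
Fact polu_scale1 : left_id 1 polu_scale.
Proof. by polu ueq_scale1. Qed.
Fact polu_scaleDr : right_distributive polu_scale +%R.
Proof.
move=> k; do 2 elim/PolU_ind_pi => ?.
by rewrite /+%R /= !piE; apply/PolU_eqP; constructor.
Qed.
Fact polu_scaleDl x : {morph polu_scale^~ x : k l / k + l}.
Proof.
move=> k l; elim/PolU_ind_pi: x => x.
by rewrite [RHS]/+%R /= !piE; apply/PolU_eqP; constructor.
Qed.

HB.instance Definition _ := GRing.Zmodule_isLmodule.Build C PolU
  polu_scaleA polu_scale1 polu_scaleDr polu_scaleDl.

Fact polu_starK : involutive polu_star. Proof. by polu ueq_starK. Qed.
Fact polu_starD : {morph polu_star : a b / a + b}.
Proof.
by do 2 elim/PolU_ind_pi => ?; rewrite /+%R /= !piE; apply/PolU_eqP; constructor.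
Qed.
Fact polu_starM (a b : PolU) : polu_star (a * b) = polu_star b * polu_star a.
Proof.
elim/PolU_ind_pi: a => a; elim/PolU_ind_pi: b => b.
by rewrite /*%R /= !piE; apply/PolU_eqP; constructor.
Qed.

HB.instance Definition _ :=
  isStarRing.Build PolU polu_starK polu_starD polu_starM.

Fact polu_starZ (k : C) (a : PolU) : star (k *: a) = Num.conj k *: star a.
Proof.
elim/PolU_ind_pi: a => a; rewrite /( *:%R) /star /= !piE.
by apply/PolU_eqP; constructor.
Qed.
Fact polu_scaleAl (k : C) (a b : PolU) : k *: (a * b) = (k *: a) * b.
Proof.
elim/PolU_ind_pi: a => a; elim/PolU_ind_pi: b => b.
rewrite /( *:%R) /= /( *%R) /= !piE.
by apply/PolU_eqP; constructor.
Qed.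
Fact polu_scaleAr (k : C) (a b : PolU) : k *: (a * b) = a * (k *: b).
Proof.
elim/PolU_ind_pi: a => a; elim/PolU_ind_pi: b => b.
rewrite /( *:%R) /= /( *%R) /= !piE.
by apply/PolU_eqP; constructor.
Qed.

Section Evaluation.
Variables (B : starAlgType C) (v : 'M[B]_d).

Fixpoint ueval (t : uterm) : B :=
  match t with
  | UGen j k => v j k
  | UZero => 0
  | UOne => 1
  | UOpp a => - ueval a
  | UAdd a b => ueval a + ueval b
  | UMul a b => ueval a * ueval b
  | UScale k a => k *: ueval a
  | UStar a => star (ueval a)
  end.

Lemma ueval_sum (F : 'I_d -> uterm) :
  ueval (\big[UAdd/UZero]_(p < d) F p) = \sum_(p < d) ueval (F p).
Proof. by apply: (big_morph ueval). Qed.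

Lemma ueval_delta j k : ueval (udelta j k) = (j == k)%:R.
Proof. by rewrite /udelta; case: eqP. Qed.

Hypothesis v_biunitary : biunitary v.

Lemma ueval_eq a b : ueq a b -> ueval a = ueval b.
Proof.
case: v_biunitary => v1 v2 v3 v4.
elim=> {a b} /=; try by move=> *; congruence.
- by move=> a b c; rewrite addrA.
- by move=> a b; rewrite addrC.
- by move=> a; rewrite add0r.
- by move=> a; rewrite addNr.
- by move=> a b c; rewrite mulrA.
- by move=> a; rewrite mul1r.
- by move=> a; rewrite mulr1.
- by move=> a b c; rewrite mulrDl.
- by move=> a b c; rewrite mulrDr.
- by move=> k l a; rewrite scalerA.
- by move=> a; rewrite scale1r.
- by move=> k a b; rewrite scalerDr.
- by move=> k l a; rewrite scalerDl.
- by move=> k a b; rewrite scalerAl.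
- by move=> k a b; rewrite scalerAr.
- by move=> a; rewrite starK.
- by move=> a b; rewrite starD.
- by move=> a b; rewrite starM.
- by move=> k a; rewrite starZ.
- move=> j k; move/matrixP: v1 => /(_ j k); rewrite !mxE ueval_sum ueval_delta.
  by move=> <-; apply: eq_bigr => p _; rewrite !mxE.
- move=> j k; move/matrixP: v2 => /(_ j k); rewrite !mxE ueval_sum ueval_delta.
  by move=> <-; apply: eq_bigr => p _; rewrite !mxE.
- move=> j k; move/matrixP: v3 => /(_ j k); rewrite !mxE ueval_sum ueval_delta.
  by move=> <-; apply: eq_bigr => p _; rewrite !mxE.
- move=> j k; move/matrixP: v4 => /(_ j k); rewrite !mxE ueval_sum ueval_delta.
  by move=> <-; apply: eq_bigr => p _; rewrite !mxE.
Qed.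

Definition PolU_lift (x : PolU) : B := ueval (repr x).

Lemma PolU_lift_pi a : PolU_lift (\pi_PolU a) = ueval a.
Proof. by apply: ueval_eq; exact: PolU_repr. Qed.
End Evaluation.

Lemma biunitary1 (B : starAlgType C) : biunitary (1%:M : 'M[B]_d).
Proof.
have star0 : star (0 : B) = 0.
  by apply: (addIr (star 0)); rewrite -starD !add0r.
have star1 : star (1 : B) = 1.
  by rewrite -[LHS]mulr1 -[X in _ * X]starK -starM mulr1 starK.
have bar1 : barmx (1%:M : 'M[B]_d) = 1%:M.
  by apply/matrixP => i j; rewrite !mxE; case: eqP.
by rewrite /biunitary /adjmx bar1 !trmx1 !mul1mx.
Qed.

Fact polu_oner_neq0 : (1 : PolU) != 0.
Proof.
apply/eqP => /PolU_eqP /(ueval_eq (biunitary1 C^o)) /= /eqP.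
by rewrite oner_eq0.
Qed.

HB.instance Definition _ :=
  GRing.PzSemiRing_isNonZero.Build PolU polu_oner_neq0.
HB.instance Definition _ := GRing.Lmodule_isLalgebra.Build C PolU polu_scaleAl.
HB.instance Definition _ := GRing.Lalgebra_isAlgebra.Build C PolU polu_scaleAr.
HB.instance Definition _ := isStarAlgebra.Build C PolU polu_starZ.

Definition genU : 'M[PolU]_d := \matrix_(j, k) \pi_PolU (UGen j k).

Lemma pi_sum (F : 'I_d -> uterm) :
  \pi_PolU (\big[UAdd/UZero]_(p < d) F p) = \sum_(p < d) \pi_PolU (F p).
Proof. by apply: big_morph => [a b|//]; rewrite -pi_add. Qed.

Lemma pi_delta j k : \pi_PolU (udelta j k) = (j == k)%:R.
Proof. by rewrite /udelta; case: eqP. Qed.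

Lemma genU_biunitary : biunitary genU.
Proof.
split; apply/matrixP => j k; rewrite !mxE -pi_delta.
- rewrite -(proj2 (PolU_eqP _ _) (ueq_u_ustar j k)) pi_sum.
  by apply: eq_bigr => p _; rewrite !mxE -pi_mul -pi_star.
- rewrite -(proj2 (PolU_eqP _ _) (ueq_ustar_u j k)) pi_sum.
  by apply: eq_bigr => p _; rewrite !mxE -pi_mul -pi_star.
- rewrite -(proj2 (PolU_eqP _ _) (ueq_ubar_ut j k)) pi_sum.
  by apply: eq_bigr => p _; rewrite !mxE -pi_mul -pi_star.
- rewrite -(proj2 (PolU_eqP _ _) (ueq_ut_ubar j k)) pi_sum.
  by apply: eq_bigr => p _; rewrite !mxE -pi_mul -pi_star.
Qed.

Lemma PolU_ind (P : PolU -> Prop) :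
  (forall j k, P (genU j k)) -> P 0 -> P 1 ->
  (forall a, P a -> P (- a)) ->
  (forall a b, P a -> P b -> P (a + b)) ->
  (forall a b, P a -> P b -> P (a * b)) ->
  (forall k a, P a -> P (k *: a)) ->
  (forall a, P a -> P (star a)) ->
  forall a, P a.
Proof.
move=> Pg P0 P1 PN PD PM PZ PS; elim/PolU_ind_pi.
elim=> [j k|||a Pa|a Pa b Pb|a Pa b Pb|k a Pa|a Pa] //.
- by have := Pg j k; rewrite mxE.
- by rewrite -pi_opp; apply: PN.
- by rewrite -pi_add; apply: PD.
- by rewrite -pi_mul; apply: PM.
- by rewrite -pi_scale; apply: PZ.
- by rewrite -pi_star; apply: PS.
Qed.

Section Universal.
Variables (B : starAlgType C) (v : 'M[B]_d) (v_biunitary : biunitary v).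

Lemma PolU_lift_linear : linear (PolU_lift v).
Proof.
move=> k; do 2 elim/PolU_ind_pi => ?.
by rewrite /( *:%R) /+%R /= !piE !(PolU_lift_pi v_biunitary).
Qed.

Lemma PolU_lift_monoid : monoid_morphism (PolU_lift v).
Proof.
split=> [|a b]; first exact: (PolU_lift_pi v_biunitary UOne).
elim/PolU_ind_pi: a => a; elim/PolU_ind_pi: b => b.
by rewrite [in LHS]/( *%R) /= !piE !(PolU_lift_pi v_biunitary).
Qed.

Lemma PolU_lift_star a : PolU_lift v (star a) = star (PolU_lift v a).
Proof.
elim/PolU_ind_pi: a => a.
by rewrite [in LHS]/star /= !piE !(PolU_lift_pi v_biunitary).
Qed.

Lemma PolU_lift_gen : map_mx (PolU_lift v) genU = v.
Proof. by apply/matrixP => j k; rewrite !mxE (PolU_lift_pi v_biunitary). Qed.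

Definition PolU_liftM := let _ := v_biunitary in PolU_lift v.
HB.instance Definition _ :=
  GRing.isLinear.Build C PolU B *:%R PolU_liftM PolU_lift_linear.
HB.instance Definition _ :=
  GRing.isMonoidMorphism.Build PolU B PolU_liftM PolU_lift_monoid.

Theorem PolU_universal :
  exists f : {lrmorphism PolU -> B},
    [/\ forall a, f (star a) = star (f a), map_mx f genU = v &
        forall g : {lrmorphism PolU -> B}, (forall a, g (star a) = star (g a)) ->
          map_mx g genU = v -> f =1 g].
Proof.
exists PolU_liftM; split; [exact: PolU_lift_star|exact: PolU_lift_gen|].
move=> g gS gg; elim/PolU_ind.
- move=> j k; move/matrixP: PolU_lift_gen => /(_ j k); rewrite mxE.
  by rewrite -{2}gg [in RHS]mxE.
- by rewrite !raddf0.
- by rewrite !rmorph1.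
- by move=> a IH; rewrite !raddfN; congr (- _).
- by move=> a b IHa IHb; rewrite !raddfD; congr (_ + _).
- by move=> a b IHa IHb; rewrite !rmorphM; congr (_ * _).
- by move=> k a IH; rewrite !linearZ; congr (_ *: _).
- move=> a IH; rewrite gS; transitivity (star (PolU_liftM a)).
    exact: PolU_lift_star.
  by congr star.
Qed.
End Universal.

End PolUTerms.

Arguments genU : clear implicits.

(* the character epsilon of Pol(U_d^+) *)
Definition counit (C : numClosedFieldType) (d : nat) :
    {lrmorphism PolU C d -> C^o} := PolU_liftM (biunitary1 d C^o).

Lemma counit_star (C : numClosedFieldType) (d : nat) (a : PolU C d) :
  counit C d (star a) = Num.conj (counit C d a).
Proof. exact: (PolU_lift_star (biunitary1 d C^o)). Qed.

Lemma counit_gen (C : numClosedFieldType) (d : nat) :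
  map_mx (counit C d) (genU C d) = 1%:M.
Proof. exact: (PolU_lift_gen (biunitary1 d C^o)). Qed.

(* [hdot] is linear in its first and conjugate-linear in its second argument;
   completeness is that of the normed module. *)
HB.mixin Record isHilbert (R : realType) H of CompleteNormedModule R[i] H := {
  hdot : {dot H for (@Num.conj R[i])};
  normr_hdot : forall x : H, `|x| ^+ 2 = hdot x x
}.

#[short(type="hilbertType")]
HB.structure Definition Hilbert (R : realType) :=
  {H of CompleteNormedModule R[i] H & isHilbert R H}.

Section HilbertTheory.
Variables (R : realType) (H : hilbertType R).
Local Notation C := R[i].
Implicit Types x y z : H.

Lemma hdotC x y : hdot y x = Num.conj (hdot x y).
Proof. by rewrite hermC expr0 mul1r. Qed.

Lemma hdotZr (k : C) x y : hdot x (k *: y) = Num.conj k * hdot x y.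
Proof. by rewrite linearZr_LR. Qed.

Lemma hdotZl (k : C) x y : hdot (k *: x) y = k * hdot x y.
Proof. by rewrite linearZl_LR. Qed.

Lemma hdot_proj x y : y != 0 ->
  `|x - (hdot x y / `|y| ^+ 2) *: y| ^+ 2 =
  `|x| ^+ 2 - `|hdot x y| ^+ 2 / `|y| ^+ 2.
Proof.
move=> y0; have ny : `|y| ^+ 2 != 0 by rewrite expf_neq0// normr_eq0.
rewrite normr_hdot dnormB dnormZ -!normr_hdot hdotZr.
set a := hdot x y.
have -> : Num.conj (a / `|y| ^+ 2) * a = `|a| ^+ 2 / `|y| ^+ 2.
  rewrite rmorphM/= [X in _ * X * _]conj_Creal ?rpredV ?rpredX ?normr_real//.
  by rewrite mulrAC [_ * a]mulrC -normCK.
have -> : Num.conj (`|a| ^+ 2 / `|y| ^+ 2) = `|a| ^+ 2 / `|y| ^+ 2.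
  by rewrite conj_Creal// rpredM ?rpredV ?rpredX ?normr_real.
rewrite normrM normfV [`| `|y| ^+ 2|]ger0_norm ?exprn_ge0// exprMn.
move: (`|y| ^+ 2) ny => q q0.
have -> : `|a| ^+ 2 * q^-1 ^+ 2 * q = `|a| ^+ 2 / q.
  by rewrite -mulrA expr2 mulfVK.
by rewrite opprD addrA addrK.
Qed.

Lemma hdot_le x y : `|hdot x y| <= `|x| * `|y|.
Proof.
have [->|y0] := eqVneq y 0; first by rewrite linear0r !normr0 mulr0.
have ny : 0 < `|y| ^+ 2 by rewrite exprn_gt0// normr_gt0.
have := exprn_ge0 2 (normr_ge0 (x - (hdot x y / `|y| ^+ 2) *: y)).
rewrite hdot_proj// subr_ge0 ler_pdivrMr// -exprMn.
by rewrite ler_pXn2r// nnegrE ?mulr_ge0.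
Qed.

Lemma hdot_ext x y : (forall z, hdot z x = hdot z y) -> x = y.
Proof.
move=> xy; apply/eqP; rewrite -subr_eq0 -(dnorm_eq0 hdot).
by rewrite linearBr/= xy subrr.
Qed.

Lemma hparallelogram x y :
  `|x + y| ^+ 2 + `|x - y| ^+ 2 = 2 * (`|x| ^+ 2 + `|y| ^+ 2).
Proof.
rewrite !normr_hdot dnormD dnormB -!normr_hdot addrACA subrr addr0.
by rewrite mulr_natl mulr2n.
Qed.

(* the norm of H is C-valued; hnorm is the same number in R *)
Definition hnorm x : R := complex.Re `|x|.

Lemma hnormE x : `|x| = (hnorm x)%:C%C.
Proof. by rewrite RRe_real ?normr_real. Qed.

Lemma hnorm_ge0 x : 0 <= hnorm x.
Proof. by rewrite -(@lecR R) -hnormE normr_ge0. Qed.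

Theorem riesz (phi : H -> C) (M : C) : scalar phi ->
  (forall x, `|phi x| <= M * `|x|) ->
  exists z, forall x, phi x = hdot x z.
Proof.
move=> phil phiM.
have phiD x y : phi (x + y) = phi x + phi y.
  by have := phil 1 x y; rewrite scale1r mul1r.
have phi0 : phi 0 = 0 by apply: (addIr (phi 0)); rewrite -phiD !add0r.
have phiZ k x : phi (k *: x) = k * phi x.
  by have := phil k x 0; rewrite addr0 phi0 addr0.
have phiB x y : phi (x - y) = phi x - phi y by rewrite phiD -scaleN1r phiZ mulN1r.
have [phiE|/existsNP[x0 phix0]] := pselect (forall x, phi x = 0).
  by exists 0 => x; rewrite phiE linear0r.
pose E : set R := [set hnorm x | x in [set x | phi x = 1]].
have E0 : E !=set0.
  exists (hnorm ((phi x0)^-1 *: x0)), ((phi x0)^-1 *: x0) => //=.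
  by rewrite phiZ mulVf//; apply/eqP.
have Elb : lbound E 0 by move=> _ [x _ <-]; exact: hnorm_ge0.
have hE : has_inf E by split => //; exists 0.
pose m := inf E.
have m_ge0 : 0 <= m by apply: lb_le_inf.
have mE x : phi x = 1 -> m <= hnorm x.
  by move=> x1; apply: ge_inf; [exists 0|exists x].
have /choice[u uE] : forall n : nat, exists x, phi x = 1 /\ hnorm x < m + n.+1%:R^-1.
  move=> n; have n0 : 0 < n.+1%:R^-1 :> R by rewrite invr_gt0 ltr0n.
  have [_ [x x1 <-] xm] := inf_adherent n0 hE.
  by exists x.
have u_cauchy n N : (N <= n)%N ->
    hnorm (u N - u n) ^+ 2 <= (8 * m + 4) * N.+1%:R^-1.
  move=> Nn; set dl := N.+1%:R^-1.
  have dl0 : 0 <= dl by rewrite invr_ge0.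
  have dl1 : dl <= 1 by rewrite invf_le1 ?ler1n.
  have sm k : (N <= k)%N -> hnorm (u k) ^+ 2 <= (m + dl) ^+ 2.
    move=> Nk; rewrite ler_pXn2r ?nnegrE ?hnorm_ge0 ?addr_ge0//.
    rewrite (le_trans (ltW (uE k).2))// lerD2l lef_pV2 ?posrE ?ltr0n//.
    by rewrite ler_nat.
  have mid : 4 * m ^+ 2 <= hnorm (u N + u n) ^+ 2.
    have h2 : hnorm (u N + u n) = 2 * hnorm (2^-1 *: (u N + u n)).
      apply: (@complexI R); rewrite rmorphM/= -!hnormE normrZ ger0_norm//.
      by rewrite rmorph_nat mulrA divff ?mul1r ?pnatr_eq0.
    rewrite h2 exprMn -natrX ler_pM2l ?ltr0n// ler_pXn2r ?nnegrE ?hnorm_ge0//.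
    apply: mE; rewrite phiZ phiD (uE _).1 (uE _).1.
    by rewrite -[1 + 1]/(2 : C) mulVf ?pnatr_eq0.
  have par : hnorm (u N + u n) ^+ 2 + hnorm (u N - u n) ^+ 2 =
      2 * (hnorm (u N) ^+ 2 + hnorm (u n) ^+ 2).
    apply: (@complexI R); rewrite !(rmorphM, rmorphD, rmorphXn, rmorph_nat)/=.
    by rewrite -!hnormE hparallelogram.
  have /(_ _ (leqnn N)) s1 := sm; have /(_ _ Nn) s2 := sm.
  have dl2 : dl ^+ 2 <= dl by rewrite expr2 ler_piMl.
  move: s1 s2 par mid; move: (hnorm (u N) ^+ 2) (hnorm (u n) ^+ 2).
  move: (hnorm (u N + u n) ^+ 2) (hnorm (u N - u n) ^+ 2) => p q a b.
  have mdl : 0 <= m * dl by rewrite mulr_ge0.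
  clear -dl2 mdl; nra.
have /cauchy_cvgP/cvg_ex[/= L uL] : cauchy (u @ \oo).
  apply: cauchy_exP => e e0.
  have [r er] : exists r, e = r%:C%C.
    by exists (complex.Re e); rewrite RRe_real// gtr0_real.
  move: e0; rewrite er ltcR => r0.
  have [N hN] : exists N : nat, (8 * m + 4) * N.+1%:R^-1 < r ^+ 2.
    have r20 : 0 < r ^+ 2 by rewrite exprn_gt0.
    exists (Num.truncn ((8 * m + 4) / r ^+ 2)).
    rewrite ltr_pdivrMr ?ltr0n// [ltRHS]mulrC -ltr_pdivrMr//.
    exact: truncnS_gt.
  exists (u N); exists N => // n /= Nn; rewrite -ball_normE /= hnormE ltcR.
  rewrite -(@ltr_pXn2r _ 2)// ?nnegrE ?hnorm_ge0 ?(ltW r0)//.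
  by apply: le_lt_trans hN; exact: (u_cauchy _ _ Nn).
have near_L (e : R) : 0 < e -> \forall n \near \oo, hnorm (L - u n) < e.
  move=> e0; move/cvgrPdist_lt: uL => /(_ e%:C%C); rewrite ltcR => /(_ e0).
  by apply: filterS => n; rewrite hnormE ltcR.
have nD x y : hnorm (x + y) <= hnorm x + hnorm y.
  by rewrite -(@lecR R) rmorphD/= -!hnormE ler_normD.
have phiL : phi L = 1.
  apply/eqP; rewrite -subr_eq0 -normr_eq0; apply/negPn/negP => nz.
  have /complex_realP[k Mk] := normr_real M.
  have k0 : 0 <= k by have := normr_ge0 M; rewrite Mk lecR.
  pose K := k + 1.
  have K0 : 0 < K by rewrite /K addrC ltr_pwDl.
  have phiK x : `|phi x| <= K%:C%C * `|x|.
    have Mx0 := le_trans (normr_ge0 _) (phiM x).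
    rewrite (le_trans (phiM x))// -(ger0_norm Mx0) normrM normr_id Mk.
    by rewrite ler_wpM2r// lecR lerDl ler01.
  have /complex_realP[c cE] := normr_real (phi L - 1).
  have c0 : 0 < c by rewrite -ltcR -cE lt_def nz normr_ge0.
  have /near_L[N _ /(_ N (leqnn N))/= hN] : 0 < c / K by rewrite divr_gt0.
  have : c <= K * hnorm (L - u N).
    by rewrite -(@lecR R) -cE rmorphM/= -hnormE -(uE N).1 -phiB.
  by rewrite leNgt -ltr_pdivlMl// mulrC hN.
have nL : hnorm L = m.
  apply/eqP; rewrite eq_le mE// andbT; apply/ler_addgt0Pr => e e0.
  have e20 : 0 < e / 2 by rewrite divr_gt0.
  near \oo => n.
  have h1 : hnorm (L - u n) < e / 2 by near: n; exact: near_L.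
  have h2 : n.+1%:R^-1 < e / 2.
    by near: n; exact: (near_infty_natSinv_lt (PosNum e20)).
  have := nD (L - u n) (u n); rewrite subrK => h3.
  have h4 := (uE n).2.
  rewrite (le_trans h3)// [in leRHS](splitr e) addrCA lerD ?(ltW h1)//.
  by rewrite (le_trans (ltW h4))// lerD2l ltW.
have orth y : phi y = 0 -> hdot L y = 0.
  move=> y0; have [->|yn0] := eqVneq y 0; first by rewrite linear0r.
  have ny : 0 < `|y| ^+ 2 by rewrite exprn_gt0// normr_gt0.
  set a := hdot L y / `|y| ^+ 2.
  have : `|L| ^+ 2 <= `|L - a *: y| ^+ 2.
    rewrite ler_pXn2r ?nnegrE ?normr_ge0// !hnormE lecR nL mE//.
    by rewrite phiB phiZ y0 mulr0 subr0.
  rewrite hdot_proj// lerBrDl gerDr pmulr_lle0 ?invr_gt0// => h.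
  have : `|hdot L y| ^+ 2 == 0 by rewrite eq_le h exprn_ge0.
  by rewrite expf_eq0 normr_eq0 => /eqP.
have L0 : `|L| ^+ 2 != 0.
  rewrite expf_neq0// normr_eq0; apply/eqP => L0.
  by move: phiL; rewrite L0 phi0 => /esym/eqP; rewrite oner_eq0.
exists ((`|L| ^+ 2)^-1 *: L) => x.
have /orth : phi (x - phi x *: L) = 0 by rewrite phiB phiZ phiL mulr1 subrr.
rewrite linearBr/= hdotZr -normr_hdot => /eqP; rewrite subr_eq0 => /eqP hL.
rewrite hdotZr hdotC hL rmorphM/= conjCK.
rewrite !conj_Creal ?rpredV ?rpredX ?normr_real//.
by rewrite mulrCA mulVf// mulr1.
Unshelve. all: by end_near. Qed.

End HilbertTheory.

Section BoundedOperators.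
Variables (R : realType) (H : hilbertType R).
Local Notation C := R[i].

Definition bounded_operator : {pred H -> H} := fun f =>
  `[< linear f /\ exists M : C, forall x, `|f x| <= M * `|x| >].

Record bop := Bop {
  bop_fun :> H -> H;
  bop_subproof : bop_fun \in bounded_operator
}.

HB.instance Definition _ := [isSub for bop_fun].
HB.instance Definition _ := [Choice of bop by <:].

Lemma bopP (T : bop) : linear T /\ exists M : C, forall x, `|T x| <= M * `|x|.
Proof. exact/asboolP/bop_subproof. Qed.

HB.instance Definition _ (T : bop) :=
  GRing.isLinear.Build C H H *:%R T (bopP T).1.

Lemma bop_ext (S T : bop) : S =1 T -> S = T.
Proof. by move=> ST; apply: val_inj; apply/funext. Qed.

Fact bounded_operator_submod : submod_closed bounded_operator.
Proof.
split.
  apply/asboolP; split=> [k x y|]; first by rewrite /= scaler0 addr0.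
  by exists 0 => x; rewrite mul0r normr0.
move=> k f g /asboolP [lf [M fM]] /asboolP [lg [N gN]]; apply/asboolP; split.
  move=> l x y; rewrite /= !fctE lf lg !scalerDr !scalerA (mulrC k l).
  by rewrite -!addrA; congr (_ + _); rewrite addrCA.
exists (`|k| * M + N) => x; rewrite mulrDl -mulrA.
rewrite (le_trans (ler_normD _ _))// lerD// normrZ.
by rewrite ler_wpM2l.
Qed.
HB.instance Definition _ :=
  GRing.isSubmodClosed.Build C (H -> H) bounded_operator bounded_operator_submod.
HB.instance Definition _ := [SubChoice_isSubLmodule of bop by <:].

Fact bop_id_subproof : idfun \in bounded_operator.
Proof.
by apply/asboolP; split=> [k x y//|]; exists 1 => x; rewrite mul1r.
Qed.
Definition bop_id : bop := Bop bop_id_subproof.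

Fact bop_comp_subproof (S T : bop) : S \o T \in bounded_operator.
Proof.
apply/asboolP; have [lS [M SM]] := bopP S; have [lT [N TN]] := bopP T.
split=> [k x y|]; first by rewrite /= lT lS.
exists (`|M| * N) => x /=; rewrite (le_trans (SM _))//.
have MT0 := le_trans (normr_ge0 _) (SM (T x)).
by rewrite -(ger0_norm MT0) normrM normr_id -mulrA ler_wpM2l.
Qed.
Definition bop_comp (S T : bop) : bop := Bop (bop_comp_subproof S T).

Lemma bop_addE (S T : bop) x : (S + T) x = S x + T x. Proof. by []. Qed.
Lemma bop_scaleE (k : C) (T : bop) x : (k *: T) x = k *: T x. Proof. by []. Qed.
Lemma bop_zeroE x : (0 : bop) x = 0. Proof. by []. Qed.
Lemma bop_oppE (T : bop) x : (- T) x = - T x. Proof. by []. Qed.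

Fact bop_compA : associative bop_comp. Proof. by move=> *; apply: bop_ext. Qed.
Fact bop_comp1l : left_id bop_id bop_comp.
Proof. by move=> *; apply: bop_ext. Qed.
Fact bop_comp1r : right_id bop_id bop_comp.
Proof. by move=> *; apply: bop_ext. Qed.
Fact bop_compDl : left_distributive bop_comp +%R.
Proof. by move=> *; apply: bop_ext. Qed.
Fact bop_compDr : right_distributive bop_comp +%R.
Proof. by move=> S T U; apply: bop_ext => x; rewrite /= raddfD. Qed.

HB.instance Definition _ := GRing.Zmodule_isPzRing.Build bop
  bop_compA bop_comp1l bop_comp1r bop_compDl bop_compDr.

Lemma bop_mulE (S T : bop) x : (S * T) x = S (T x). Proof. by []. Qed.
Lemma bop_oneE x : (1 : bop) x = x. Proof. by []. Qed.

(* existence of adjoints, by the Riesz representation theorem *)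
Lemma adjoint_exists (T : bop) :
  exists S : bop, forall x y, hdot (T x) y = hdot x (S y).
Proof.
have [lT [M TM]] := bopP T.
have /choice[S ST] : forall y, exists z, forall x, hdot (T x) y = hdot x z.
  move=> y; apply: (@riesz _ _ (fun x => hdot (T x) y) (M * `|y|)).
    by move=> k u v; rewrite lT linearDl/= hdotZl.
  move=> x; rewrite (le_trans (hdot_le _ _))// mulrAC.
  by rewrite ler_wpM2r.
have Sb : S \in bounded_operator.
  apply/asboolP; split=> [k x y|].
    apply: hdot_ext => z; rewrite -ST !linearDr/= !hdotZr.
    by rewrite !ST.
  exists `|M| => y; have [->|Sy0] := eqVneq (S y) 0.
    by rewrite normr0 mulr_ge0.
  have Sy_gt0 : 0 < `|S y| by rewrite normr_gt0.
  rewrite -(ler_pM2l Sy_gt0) -expr2 normr_hdot -ST.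
  have h : hdot (T (S y)) y \is Num.real.
    by rewrite ST -normr_hdot rpredX ?normr_real.
  rewrite (le_trans (real_ler_norm h))// (le_trans (hdot_le _ _))//.
  rewrite mulrA ler_wpM2r//.
  have MS0 := le_trans (normr_ge0 _) (TM (S y)).
  rewrite (le_trans (TM _))//.
  by rewrite -(ger0_norm MS0) normrM normr_id mulrC.
by exists (Bop Sb) => x y /=; rewrite ST.
Qed.

Definition adjoint (T : bop) : bop := sval (cid (adjoint_exists T)).

Lemma adjointP (T : bop) x y : hdot (T x) y = hdot x (adjoint T y).
Proof. exact: (svalP (cid (adjoint_exists T))). Qed.

Lemma adjoint_unique (T S : bop) :
  (forall x y, hdot (T x) y = hdot x (S y)) -> S = adjoint T.
Proof.
move=> TS; apply: bop_ext => y; apply: hdot_ext => x.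
by rewrite -TS adjointP.
Qed.

Fact adjointK : involutive adjoint.
Proof.
move=> T; apply/esym/adjoint_unique => x y.
by rewrite hdotC -adjointP hdotC conjCK.
Qed.
Fact adjointD : {morph adjoint : S T / S + T}.
Proof.
move=> S T; apply/esym/adjoint_unique => x y.
by rewrite !bop_addE linearDl linearDr/= !adjointP.
Qed.
Fact adjointM (S T : bop) : adjoint (S * T) = adjoint T * adjoint S.
Proof. by apply/esym/adjoint_unique => x y; rewrite !bop_mulE !adjointP. Qed.

HB.instance Definition _ := isStarRing.Build bop adjointK adjointD adjointM.

Definition actmx m n p (X : 'M[bop]_(m, n)) (Y : 'M[H]_(n, p)) : 'M[H]_(m, p) :=
  \matrix_(j, k) \sum_q X j q (Y q k).

End BoundedOperators.

Section Cocycles.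
Variables (R : realType) (d : nat) (H : hilbertType R).
Local Notation C := R[i].

Definition star_rep (rho : PolU C d -> bop H) : Prop :=
  [/\ linear rho, monoid_morphism rho & forall a, rho (star a) = star (rho a)].

Definition cocycle (rho : PolU C d -> bop H) (eta : PolU C d -> H) : Prop :=
  linear eta /\
  forall a b, eta (a * b) = rho a (eta b) + counit C d b *: eta a.
End Cocycles.

(* Main.v *)
(* A cocycle is determined by its values V on the u_jk and W on the u_jk^*, and
   such a prescription is consistent with a relation X Y = I iff the Leibniz
   rule sends it to 0.  The four relations give
     R W^t + V = 0,  R^* V + W^t = 0,  \bar R V^t + W = 0,  R^t W + V^t = 0.
   The third one forces W = - \bar R V^t, the second is then (ii), and the other
   two follow from these because R R^* = I and R^t \bar R = I. *)
Require Import Defs.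
From HB Require Import structures.
From mathcomp Require Import all_boot all_order all_algebra.
From mathcomp Require Import all_classical all_reals all_analysis.
From mathcomp.real_closed Require Import complex.

Set Implicit Arguments.
Unset Strict Implicit.
Unset Printing Implicit Defensive.

Import GRing.Theory.
Local Open Scope ring_scope.

(** * Operator matrices acting on matrices of vectors *)

Section Actmx.
Variables (R : realType) (H : hilbertType R).

Lemma actmx_mul m n p q (X : 'M[bop H]_(m, n)) (Y : 'M[bop H]_(n, p))
    (Z : 'M[H]_(p, q)) : actmx (X *m Y) Z = actmx X (actmx Y Z).
Proof.
apply/matrixP => j k; rewrite !mxE.
under [RHS]eq_bigr do rewrite mxE raddf_sum.
rewrite exchange_big; apply: eq_bigr => r _; rewrite mxE.
(* Evaluation at a fixed vector is additive in the operator, since sums of operators are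
   pointwise. *)
exact: (big_morph (fun S : bop H => S (Z r k)) (fun=> fun=> erefl) erefl).
Qed.

Lemma actmx1 m n (Z : 'M[H]_(m, n)) : actmx 1%:M Z = Z.
Proof.
apply/matrixP => j k; rewrite mxE (bigD1 j)//= mxE eqxx big1 ?addr0// => i ij.
by rewrite mxE eq_sym (negPf ij).
Qed.

Lemma actmxN m n p (X : 'M[bop H]_(m, n)) (Z : 'M[H]_(n, p)) :
  actmx X (- Z) = - actmx X Z.
Proof.
apply/matrixP => j k; rewrite !mxE -sumrN.
by apply: eq_bigr => i _; rewrite mxE raddfN.
Qed.

(** Puts a matrix identity in the entrywise form that the Leibniz rule produces on the defining
    relations. *)
Lemma actmx_eqN m n p (X : 'M[bop H]_(m, n)) (Y : 'M[H]_(n, p)) Z :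
  actmx X Y = - Z -> forall j k, \sum_q X j q (Y q k) + Z j k = 0.
Proof.
move=> /eqP; rewrite -addr_eq0 => /eqP/matrixP XYZ j k.
by have := XYZ j k; rewrite !mxE.
Qed.

End Actmx.

Lemma star1 (A : starRingType) : star (1 : A) = 1.
Proof. by rewrite -[LHS]mulr1 -[X in _ * X]starK -starM mulr1 starK. Qed.

Lemma sum_delta_scale (K : pzRingType) (M : lmodType K) n (F : 'I_n -> M) k :
  \sum_p (k == p)%:R *: F p = F k.
Proof.
rewrite (bigD1 k)//= eqxx scale1r big1 ?addr0// => p.
by rewrite eq_sym => /negPf ->; rewrite scale0r.
Qed.

Section Cocycle.
Variables (R : realType) (d : nat) (H : hilbertType R).
Local Notation C := R[i].
Local Notation u := (genU C d).
Local Notation Pi a := (\pi_(PolU C d)%qT a : PolU C d).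
Variable eps : {lrmorphism PolU C d -> C^o}.
Hypothesis eps_gen : map_mx eps u = 1%:M.
Hypothesis epsS : forall a, eps (star a) = Num.conj (eps a).
Variable rho : {rmorphism PolU C d -> bop H}.
Hypothesis rhoZ : forall k a, rho (k *: a) = k *: rho a.
Hypothesis rhoS : forall a, rho (star a) = star (rho a).
Local Notation Rm := (map_mx rho u).

Lemma map_biunitary : biunitary Rm.
Proof.
have barE : barmx Rm = map_mx rho (barmx u).
  by apply/matrixP => j k; rewrite !mxE rhoS.
have adjE : adjmx Rm = map_mx rho (adjmx u) by rewrite /adjmx barE map_trmx.
have [u1 u2 u3 u4] := genU_biunitary C d.
split; rewrite ?adjE ?barE ?[Rm^T]map_trmx -map_mxM.
- by rewrite u1 map_mx1.
- by rewrite u2 map_mx1.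
- by rewrite u3 map_mx1.
- by rewrite u4 map_mx1.
Qed.

(** * Constraints on the values of a given cocycle *)

Section Values.
Variable eta : {linear PolU C d -> H}.
Hypothesis etaM : forall a b, eta (a * b) = rho a (eta b) + eps b *: eta a.

Lemma cocycle1 : eta 1 = 0.
Proof.
have := etaM 1 1; rewrite mulr1 !rmorph1 bop_oneE scale1r => eta11.
by apply: (addIr (eta 1)); rewrite add0r -eta11.
Qed.

(** Apply [eta] to each entry of [X *m Y = 1]. The right side vanishes because [eta] kills 0 and 1;
    on the left, [eps Y = 1] collapses the second Leibniz term to [eta X]. *)
Lemma cocycle_mx (X Y : 'M[PolU C d]_d) :
  map_mx eps Y = 1%:M -> X *m Y = 1%:M ->
  actmx (map_mx rho X) (map_mx eta Y) = - map_mx eta X.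
Proof.
move=> Y1 XY; apply/eqP; rewrite -addr_eq0; apply/eqP/matrixP => j k.
have : eta ((X *m Y) j k) = 0.
  rewrite XY mxE; case: eqP => _; first exact: cocycle1.
  exact: (raddf0 eta).
rewrite mxE (raddf_sum eta) => E; rewrite !mxE -{}[RHS]E.
under [RHS]eq_bigr do rewrite /= etaM.
rewrite big_split/=; congr (_ + _); first by apply: eq_bigr => p _; rewrite !mxE.
(* Expand [eta (X j k)] against the Kronecker delta, whose entries are the [eps (Y p k)]. *)
rewrite -(sum_delta_scale (fun p => eta (X j p))); apply: eq_bigr => p _.
by have /matrixP/(_ p k) := Y1; rewrite !mxE eq_sym => ->.
Qed.

End Values.

(** * Construction of a cocycle from prescribed values *)

Section Existence.
Variables V W : 'M[H]_d.

(* [ceval false t] is the value of the cocycle at [t], and [ceval true t] its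
   value at the adjoint of [t]. *)
Fixpoint ceval (s : bool) (t : uterm C d) : H :=
  match t with
  | UGen j k => if s then W j k else V j k
  | UZero | UOne => 0
  | UOpp a => - ceval s a
  | UAdd a b => ceval s a + ceval s b
  | UMul a b =>
      if s then rho (star (Pi b)) (ceval s a) + eps (star (Pi a)) *: ceval s b
      else rho (Pi a) (ceval s b) + eps (Pi b) *: ceval s a
  | UScale k a => (if s then Num.conj k else k) *: ceval s a
  | UStar a => ceval (~~ s) a
  end.

Lemma ceval_sum s (F : 'I_d -> uterm C d) :
  ceval s (\big[@UAdd C d/@UZero C d]_(p < d) F p) = \sum_(p < d) ceval s (F p).
Proof. exact: (big_morph (ceval s)). Qed.

Lemma ceval_delta s j k : ceval s (udelta C j k) = 0.
Proof. by rewrite /udelta; case: eqP. Qed.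

Lemma Pi_gen j k : Pi (UGen C j k) = u j k. Proof. by rewrite mxE. Qed.
Lemma Pi_one : Pi (UOne C d) = 1. Proof. by []. Qed.
Lemma Pi_opp a : Pi (UOpp a) = - Pi a. Proof. by rewrite -Defs.pi_opp. Qed.
Lemma Pi_add a b : Pi (UAdd a b) = Pi a + Pi b.
Proof. by rewrite -Defs.pi_add. Qed.
Lemma Pi_mul a b : Pi (UMul a b) = Pi a * Pi b.
Proof. by rewrite -Defs.pi_mul. Qed.
Lemma Pi_scale k a : Pi (UScale k a) = k *: Pi a.
Proof. by rewrite -Defs.pi_scale. Qed.
Lemma Pi_star a : Pi (UStar a) = star (Pi a).
Proof. by rewrite -Defs.pi_star. Qed.

Hypothesis VW1 : actmx Rm W^T = - V.
Hypothesis VW2 : actmx (adjmx Rm) V = - W^T.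
Hypothesis VW3 : actmx (barmx Rm) V^T = - W.
Hypothesis VW4 : actmx Rm^T W = - V^T.

Let rel1 j k : \sum_p rho (u j p) (W k p) + V j k = 0.
Proof.
rewrite -[RHS](actmx_eqN VW1 j k) ?mxE; congr (_ + _).
by apply: eq_bigr => p _; rewrite !mxE.
Qed.
Let rel2 j k : \sum_p rho (star (u p j)) (V p k) + W k j = 0.
Proof.
rewrite -[RHS](actmx_eqN VW2 j k) ?mxE; congr (_ + _).
by apply: eq_bigr => p _; rewrite !mxE rhoS.
Qed.
Let rel3 j k : \sum_p rho (star (u j p)) (V k p) + W j k = 0.
Proof.
rewrite -[RHS](actmx_eqN VW3 j k) ?mxE; congr (_ + _).
by apply: eq_bigr => p _; rewrite !mxE rhoS.
Qed.
Let rel4 j k : \sum_p rho (u p j) (W p k) + V k j = 0.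
Proof.
rewrite -[RHS](actmx_eqN VW4 j k) ?mxE; congr (_ + _).
by apply: eq_bigr => p _; rewrite !mxE.
Qed.

Let piE := (Pi_one, Pi_opp, Pi_add, Pi_mul, Pi_scale, Pi_star, Pi_gen).

Let epsE j k : eps (u j k) = (j == k)%:R.
Proof. by have /matrixP/(_ j k) := eps_gen; rewrite !mxE. Qed.
Let eps_starE j k : eps (star (u j k)) = (j == k)%:R.
Proof. by rewrite epsS epsE rmorph_nat. Qed.
Let genE := (epsE, eps_starE).

(** By induction on the derivation of [ueq]. Both values of [s] are carried along because [UStar]
    exchanges them. *)
Lemma ceval_eq a b : ueq a b -> forall s, ceval s a = ceval s b.
Proof.
elim=> {a b} //=.
- by move=> a b c _ ab _ bc s; rewrite ab.
- by move=> a a' _ aa' s; rewrite aa'.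
- by move=> a a' b b' _ aa' _ bb' s; rewrite aa' bb'.
(* The coefficients in [ceval] of a product involve only the classes [Pi a] and [Pi b], so congruent
   factors give equal coefficients. *)
- move=> a a' b b' /PolU_eqP aa' IHa /PolU_eqP bb' IHb s.
  by rewrite aa' bb' IHa IHb.
- by move=> k a a' _ aa' s; rewrite aa'.
- by move=> a b c s; rewrite addrA.
- by move=> a b s; rewrite addrC.
- by move=> a s; rewrite add0r.
- by move=> a s; rewrite addNr.
(* For [s = false] both bracketings give rho(a)rho(b)eta(c) + eps(c)rho(a)eta(b) +
   eps(b)eps(c)eta(a). *)
- move=> a b c [] /=; rewrite !piE ?starM !rmorphM !bop_mulE scalerDr scalerA.
    by rewrite raddfD/= linearZ/= addrA [eps _ * eps _]mulrC.
  by rewrite raddfD/= linearZ/= addrA [eps _ * eps _]mulrC.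
- move=> a [] /=; rewrite !piE ?star1 !rmorph1 ?bop_oneE ?raddf0.
    by rewrite scale1r add0r.
  by rewrite addr0.
- move=> a [] /=; rewrite !piE ?star1 !rmorph1 ?bop_oneE ?raddf0.
    by rewrite addr0.
  by rewrite scale1r add0r.
- move=> a b c [] /=; rewrite !piE ?starD ?rmorphD ?raddfD /=.
    by rewrite scalerDl addrACA.
  by rewrite addrACA.
- move=> a b c [] /=; rewrite !piE ?starD ?rmorphD ?raddfD /=.
    by rewrite addrACA.
  by rewrite scalerDl addrACA.
- by move=> k l a [] /=; rewrite scalerA ?rmorphM.
- by move=> a [] /=; rewrite ?rmorph1 scale1r.
- by move=> k a b s; rewrite scalerDr.
- by move=> k l a [] /=; rewrite ?rmorphD scalerDl.
- move=> k a b [] /=; rewrite !piE ?starZ scalerDr; congr (_ + _).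
  + by rewrite linearZ.
  + by rewrite scalerA linearZ.
  + by rewrite rhoZ.
  + by rewrite !scalerA mulrC.
- move=> k a b [] /=; rewrite !piE ?starZ scalerDr; congr (_ + _).
  + by rewrite rhoZ.
  + by rewrite !scalerA mulrC.
  + by rewrite linearZ.
  + by rewrite scalerA linearZ.
- by move=> a s; rewrite negbK.
- by move=> a b [] /=; rewrite !piE ?starK.
- by move=> k a [] /=; rewrite ?Num.Theory.conjCK.
(* The adjoint of the (j,k) relation is the (k,j) relation of the same family, so one [rel] lemma
   serves both values of [s], with indices swapped for [s = true]. The next three cases go the same
   way. *)
- move=> j k s; rewrite ceval_sum ceval_delta; case: s => /=;
    under eq_bigr do rewrite !piE ?starK genE;
    by rewrite big_split/= sum_delta_scale rel1.
- move=> j k s; rewrite ceval_sum ceval_delta; case: s => /=;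
    under eq_bigr do rewrite !piE ?starK genE eq_sym;
    by rewrite big_split/= sum_delta_scale rel2.
- move=> j k s; rewrite ceval_sum ceval_delta; case: s => /=;
    under eq_bigr do rewrite !piE ?starK genE;
    by rewrite big_split/= sum_delta_scale rel3.
- move=> j k s; rewrite ceval_sum ceval_delta; case: s => /=;
    under eq_bigr do rewrite !piE ?starK genE eq_sym;
    by rewrite big_split/= sum_delta_scale rel4.
Qed.

(** By [ceval_eq], [ceval false] is constant on classes, hence descends to the quotient; linearity
    and the Leibniz rule are then built into its recursion. *)
Lemma cocycle_of_values : exists eta : {linear PolU C d -> H},
  (forall a b, eta (a * b) = rho a (eta b) + eps b *: eta a) /\
  map_mx eta u = V.
Proof.
pose eta (x : PolU C d) := ceval false (repr x).
have etaE a : eta (Pi a) = ceval false a.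
  by apply: ceval_eq; exact: PolU_repr.
have eta_lin : linear eta.
  move=> k; do 2 elim/PolU_ind_pi => ?.
  by rewrite -Pi_scale -Pi_add !etaE.
pose etaL : {linear PolU C d -> H} :=
  HB.pack eta (GRing.isLinear.Build C (PolU C d) H *:%R eta eta_lin).
exists etaL; split.
- do 2 elim/PolU_ind_pi => ?.
  by rewrite -Pi_mul /= !etaE.
- by apply/matrixP => j k; rewrite !mxE /= etaE.
Qed.

End Existence.

Lemma cocycle_of_compatible (V : 'M[H]_d) :
  (actmx (adjmx Rm) V)^T = actmx (barmx Rm) V^T ->
  exists eta : {linear PolU C d -> H},
    (forall a b, eta (a * b) = rho a (eta b) + eps b *: eta a) /\
    map_mx eta u = V.
Proof.
move=> VV; have [R1 _ _ R4] := map_biunitary.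
have adjV : actmx (adjmx Rm) V = (actmx (barmx Rm) V^T)^T by rewrite -VV trmxK.
(* [W] is the value forced by the third relation. Under the hypothesis its transpose is minus
   [actmx (adjmx Rm) V], so [R1] cancels in the first relation and [R4] in the fourth. *)
apply: (@cocycle_of_values V (- actmx (barmx Rm) V^T)).
- by rewrite raddfN/= actmxN -adjV -actmx_mul R1 actmx1.
- by rewrite raddfN/= opprK adjV.
- by rewrite opprK.
- by rewrite actmxN -actmx_mul R4 actmx1.
Qed.

End Cocycle.

(** * Equivalence of (i) and (ii), with the formula for the values on adjoints *)

Theorem proposition3p2 (R : realType) (d : nat) (H : hilbertType R)
    (rho : PolU R[i] d -> bop H) (rho_rep : star_rep rho) (V : 'M[H]_d) :
  let u : 'M[PolU R[i] d]_d := genU R[i] d in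
  let Rm : 'M[bop H]_d := map_mx rho u in
  ((exists eta : PolU R[i] d -> H, cocycle rho eta /\ V = map_mx eta u)
   <-> (actmx (adjmx Rm) V)^T = actmx (barmx Rm) V^T)
  /\
  (forall eta : PolU R[i] d -> H, cocycle rho eta -> V = map_mx eta u ->
     map_mx eta (barmx u) = - actmx (barmx Rm) V^T).
Proof.
have [rho_lin rho_mon rhoS] := rho_rep.
pose rhoL : {linear PolU R[i] d -> bop H} :=
  HB.pack rho (GRing.isLinear.Build R[i] _ _ *:%R rho rho_lin).
pose rhoM : {rmorphism PolU R[i] d -> bop H} :=
  HB.pack rho (GRing.isLinear.Build R[i] _ _ *:%R rho rho_lin)
    (GRing.isMonoidMorphism.Build _ _ rho rho_mon).
have rhoZ k a : rhoM (k *: a) = k *: rhoM a by exact: (linearZZ rhoL).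
move=> u Rm.
(* The second and third relations, each solved for the values on adjoints: comparing them yields
   (ii), and the third alone is the formula for [W]. *)
have cmx (eta : PolU R[i] d -> H) : cocycle rho eta -> V = map_mx eta u ->
    map_mx eta (barmx u) = - actmx (barmx Rm) V^T /\
    actmx (adjmx Rm) V = (actmx (barmx Rm) V^T)^T.
  move=> [eta_lin etaM] VE.
  pose etaL : {linear PolU R[i] d -> H} :=
    HB.pack eta (GRing.isLinear.Build R[i] _ _ *:%R eta eta_lin).
  have bar1 : map_mx (counit R[i] d) u^T = 1%:M.
    by rewrite -map_trmx counit_gen trmx1.
  have barRm : barmx Rm = map_mx rhoM (barmx u).
    by apply/matrixP => j k; rewrite !mxE /= rhoS.
  have adjRm : adjmx Rm = map_mx rhoM (adjmx u) by rewrite /adjmx barRm map_trmx.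
  have [_ u2 u3 _] := genU_biunitary R[i] d.
  have etaE := @cocycle_mx _ _ _ (counit R[i] d) rhoM etaL etaM.
  have W3 : actmx (barmx Rm) V^T = - map_mx eta (barmx u).
    by rewrite barRm VE map_trmx (etaE _ _ bar1 u3).
  split; first by rewrite W3 opprK.
  rewrite W3 adjRm {1}VE (etaE _ _ (counit_gen _ _) u2).
  by rewrite raddfN/= map_trmx.
split=> [|eta etaP /(cmx _ etaP)[]//]; split.
  by move=> [eta [etaP /(cmx _ etaP)[_ ->]]]; rewrite trmxK.
move=> /(cocycle_of_compatible (rho := rhoM)
  (counit_gen _ _) (@counit_star _ _) rhoZ rhoS).
by move=> [eta [etaM etaV]]; exists eta; split=> //; split; [exact: linearP|].
Qed.
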